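(* Let $(X,d,\bar x)$ be a pointed metric space, let $M\subseteq X$ be a closed subspace with $\bar x\in M$, and let $K\ge1$. Then the following properties are equivalent: (a) there exists a $K$-random projection $\{\upsilon_x:x\in X\}$ on $M$; (b) there exists a bounded linear extension operator $E:\mathrm{Lip}_0(M)\to\mathrm{Lip}_0(X)$ such that (i) $\|E\|\le K$, and (ii) $E$ is weak$^*$-weak$^*$ continuous.
   Context: $\mathrm{Lip}_0(X)$ is the Banach space of real-valued Lipschitz functions on $X$ vanishing at $\bar x$, normed by the Lipschitz constant; $\mathrm{Lip}_0(M)$ is defined likewise with base point $\bar x$. ''Extension operator'' means $E(f)|_M=f$ for all $f\in\mathrm{Lip}_0(M)$. The free (Arens-Eells) space $\mathcal{F}(X)$ is the norm closure of $\mathrm{span}\{\delta_x:x\in X\}$ in $\mathrm{Lip}_0(X)^*$, where $\delta_x(f)=f(x)$; it is a canonical predual of $\mathrm{Lip}_0(X)$, and the weak$^*$ topologies on $\mathrm{Lip}_0(X)$ and $\mathrm{Lip}_0(M)$ are those induced by $\mathcal{F}(X)$ and $\mathcal{F}(M)$. For $\mu,\eta\in\mathcal{F}(M)$ set $W_1(\mu,\eta)=\|\mu-\eta\|_{\mathcal{F}(M)}$. $K$-random projection on $M$ ($K\ge1$): a family $\{\upsilon_x:x\in X\}\subseteq\mathcal{F}(M)$ such that $\upsilon_x=\delta_x$ for all $x\in M$ and $W_1(\upsilon_x,\upsilon_y)\le K\,d(x,y)$ for all $x,y\in X$. *)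

(* Defs.v *)
From HB Require Import structures.
From mathcomp Require Import all_boot all_order all_algebra.
From mathcomp Require Import all_classical all_reals all_analysis.

Set Implicit Arguments.
Unset Strict Implicit.
Unset Printing Implicit Defensive.

Import Order.TTheory GRing.Theory Num.Theory.
Import numFieldNormedType.Exports.

Local Open Scope classical_set_scope.
Local Open Scope ring_scope.

Section bound_inf.
Context {R : realType}.

Lemma ge0_inf (A : set R) : (forall L, A L -> 0 <= L) -> 0 <= inf A.
Proof.
move=> A0; have [->|/set0P Ane] := eqVneq A set0; first by rewrite inf0.
exact: lb_le_inf.
Qed.

Definition least_bound (I : Type) (p q : I -> R) : R :=
  inf [set L | 0 <= L /\ forall i, p i <= L * q i].

Lemma least_bound_ge0 (I : Type) (p q : I -> R) : 0 <= least_bound p q.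
Proof. by apply: ge0_inf => L []. Qed.

Lemma least_bound_le (I : Type) (p q : I -> R) (L : R) :
  0 <= L -> (forall i, p i <= L * q i) -> least_bound p q <= L.
Proof. by move=> L0 Lb; apply: ge_inf => //; exists 0 => ? []. Qed.

Lemma least_boundP (I : Type) (p q : I -> R) :
  (forall i, 0 <= q i) -> (exists L, forall i, p i <= L * q i) ->
  forall i, p i <= least_bound p q * q i.
Proof.
move=> q0 [L Lb] i.
have ne : [set L | 0 <= L /\ forall i, p i <= L * q i] !=set0.
  exists `|L|; split=> // j; apply: (le_trans (Lb j)).
  by rewrite ler_wpM2r// ler_norm.
have [qi0|qi0] := eqVneq (q i) 0.
  by rewrite qi0 mulr0 (le_trans (Lb i))// qi0 mulr0.
have qi : 0 < q i by rewrite lt_neqAle eq_sym qi0 q0.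
rewrite -ler_pdivrMr//; apply: lb_le_inf => // l [_ lb].
by rewrite ler_pdivrMr.
Qed.

End bound_inf.

Section operator_norm.
Context {R : realType} {V W : normedModType R}.

(* Since inf set0 = 0, this is the operator norm only for a bounded f. *)
Definition opnorm (f : V -> W) : R :=
  inf [set L | 0 <= L /\ forall v, `|f v| <= L * `|v|].

Definition bounded_op (f : V -> W) : Prop :=
  exists L : R, forall v, `|f v| <= L * `|v|.

Lemma opnormP (f : V -> W) : bounded_op f ->
  forall v, `|f v| <= opnorm f * `|v|.
Proof.
exact: (@least_boundP _ _ (fun v => `|f v|) (fun v => `|v|)).
Qed.

Lemma opnorm_le (f : V -> W) (L : R) :
  0 <= L -> (forall v, `|f v| <= L * `|v|) -> opnorm f <= L.
Proof. exact: (@least_bound_le _ _ (fun v => `|f v|) (fun v => `|v|)). Qed.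

Lemma opnorm_ge0 (f : V -> W) : 0 <= opnorm f.
Proof. exact: (@least_bound_ge0 _ _ (fun v => `|f v|) (fun v => `|v|)). Qed.

End operator_norm.

Section dual.
Context {R : realType} (V : normedModType R).

Definition dual_pred : {pred V -> R^o} :=
  [pred f : V -> R^o | `[< linear f /\ bounded_op f >]].

Record dual := Dual { dual_fun :> V -> R^o; dual_funP : dual_fun \in dual_pred }.

HB.instance Definition _ := [isSub for dual_fun].
HB.instance Definition _ := [Choice of dual by <:].

Lemma dual_predP (f : V -> R^o) :
  reflect (linear f /\ bounded_op f) (f \in dual_pred).
Proof. exact: asboolP. Qed.

Lemma dual_submod_closed : submod_closed dual_pred.
Proof.
split.
  apply/dual_predP; split.
    by move=> a u v; rewrite scaler0 addr0.
  by exists 0 => v; rewrite normr0 mul0r.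
move=> a f g /dual_predP[fl [L fL]] /dual_predP[gl [L' gL]].
apply/dual_predP; split.
  move=> b u v; rewrite /= !fctE fl gl /=.
  rewrite !scalerDr !scalerA (mulrC b a) -!addrA; congr (_ + _).
  by rewrite addrCA.
exists (`|a| * L + L') => v; rewrite !fctE mulrDl (le_trans (ler_normD _ _))//.
by rewrite lerD// normrZ -mulrA ler_wpM2l.
Qed.

HB.instance Definition _ :=
  GRing.isSubmodClosed.Build _ _ dual_pred dual_submod_closed.
HB.instance Definition _ := [SubChoice_isSubLmodule of dual by <:].

Lemma dual_linear (f : dual) : linear f.
Proof. by have /dual_predP[] := dual_funP f. Qed.

Lemma dual_bounded (f : dual) : bounded_op f.
Proof. by have /dual_predP[] := dual_funP f. Qed.

Definition dual_norm (f : dual) : R := opnorm f.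

Let dual_normD (f g : dual) : dual_norm (f + g) <= dual_norm f + dual_norm g.
Proof.
apply: opnorm_le => [|v]; first by rewrite addr_ge0// opnorm_ge0.
rewrite (le_trans (ler_normD _ _))// mulrDl lerD//; apply: opnormP;
  exact: dual_bounded.
Qed.

Let dual_normZ (a : R) (f : dual) : dual_norm (a *: f) = `|a| * dual_norm f.
Proof.
have le b (g : dual) : dual_norm (b *: g) <= `|b| * dual_norm g.
  apply: opnorm_le => [|v]; first by rewrite mulr_ge0// opnorm_ge0.
  rewrite [`|_ v|]normrZ -mulrA ler_wpM2l//; apply: opnormP.
  exact: dual_bounded.
apply/eqP; rewrite eq_le le/=; have [->|a0] := eqVneq a 0.
  by rewrite normr0 mul0r opnorm_ge0.
have := le a^-1 (a *: f); rewrite scalerA mulVf// scale1r normfV.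
by rewrite ler_pdivlMl// normr_gt0.
Qed.

Let dual_norm0_eq0 (f : dual) : dual_norm f = 0 -> f = 0.
Proof.
move=> f0; apply: val_inj; apply/funext => v; apply/eqP.
rewrite -normr_le0 (le_trans (opnormP (dual_bounded f) v))//.
by rewrite [opnorm f]f0 mul0r.
Qed.

HB.instance Definition _ :=
  Lmodule_isNormed.Build R dual dual_normD dual_normZ dual_norm0_eq0.

End dual.
Arguments dual_pred {R} V _.

Section lip0.
Context {R : realType} (X : metricType R) (x0 : X).

Definition lip0_pred : {pred X -> R^o} :=
  [pred f : X -> R^o | `[< f x0 = 0 /\
    exists L : R, forall x y, `|f x - f y| <= L * mdist x y >]].

Record lip0 := Lip0 { lip0_fun :> X -> R^o; lip0_funP : lip0_fun \in lip0_pred }.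

HB.instance Definition _ := [isSub for lip0_fun].
HB.instance Definition _ := [Choice of lip0 by <:].

Lemma lip0_predP (f : X -> R^o) : reflect (f x0 = 0 /\
    exists L : R, forall x y, `|f x - f y| <= L * mdist x y) (f \in lip0_pred).
Proof. exact: asboolP. Qed.

Lemma lip0_submod_closed : submod_closed lip0_pred.
Proof.
split.
  apply/lip0_predP; split => //.
  by exists 0 => x y; rewrite subr0 normr0 mul0r.
move=> a f g /lip0_predP[f0 [L fL]] /lip0_predP[g0 [L' gL]].
apply/lip0_predP; split; first by rewrite !fctE f0 g0 scaler0 addr0.
exists (`|a| * L + L') => x y; rewrite !fctE opprD addrACA -scalerBr mulrDl.
rewrite (le_trans (ler_normD _ _))// lerD// normrZ -mulrA ler_wpM2l//.
Qed.

HB.instance Definition _ :=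
  GRing.isSubmodClosed.Build _ _ lip0_pred lip0_submod_closed.
HB.instance Definition _ := [SubChoice_isSubLmodule of lip0 by <:].

Definition lip_norm (f : lip0) : R :=
  inf [set L | 0 <= L /\ forall x y, `|f x - f y| <= L * mdist x y].

Lemma lip0_base (f : lip0) : f x0 = 0.
Proof. by have /lip0_predP[] := lip0_funP f. Qed.

Lemma lip_norm_le (f : lip0) (L : R) : 0 <= L ->
  (forall x y, `|f x - f y| <= L * mdist x y) -> lip_norm f <= L.
Proof. by move=> L0 Lb; apply: ge_inf => //; exists 0 => ? []. Qed.

Lemma lip_normP (f : lip0) x y : `|f x - f y| <= lip_norm f * mdist x y.
Proof.
have /lip0_predP[_ [L fL]] := lip0_funP f.
have := @least_boundP R (X * X)%type (fun z => `|f z.1 - f z.2|)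
  (fun z => mdist z.1 z.2) (fun=> mdist_ge0 _ _)
  (ex_intro _ L (fun z => fL z.1 z.2)) (x, y).
congr (_ <= inf _ * _); apply/seteqP; split => l [l0 lb]; split=> //.
by move=> u v; exact: (lb (u, v)).
Qed.

Lemma lip_norm_ge0 (f : lip0) : 0 <= lip_norm f.
Proof. by apply: ge0_inf => L []. Qed.

Let lip_normD (f g : lip0) : lip_norm (f + g) <= lip_norm f + lip_norm g.
Proof.
apply: lip_norm_le => [|x y]; first by rewrite addr_ge0// lip_norm_ge0.
rewrite [(f + g) x]/(f x + g x) [(f + g) y]/(f y + g y) opprD addrACA mulrDl.
by rewrite (le_trans (ler_normD _ _))// lerD// lip_normP.
Qed.

Let lip_normZ (a : R) (f : lip0) : lip_norm (a *: f) = `|a| * lip_norm f.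
Proof.
have le b (g : lip0) : lip_norm (b *: g) <= `|b| * lip_norm g.
  apply: lip_norm_le => [|x y]; first by rewrite mulr_ge0// lip_norm_ge0.
  rewrite [(b *: g) x]/(b *: g x) [(b *: g) y]/(b *: g y) -scalerBr normrZ.
  by rewrite -mulrA ler_wpM2l// lip_normP.
apply/eqP; rewrite eq_le le/=; have [->|a0] := eqVneq a 0.
  by rewrite normr0 mul0r lip_norm_ge0.
have := le a^-1 (a *: f); rewrite scalerA mulVf// scale1r normfV.
by rewrite ler_pdivlMl// normr_gt0.
Qed.

Let lip_norm0_eq0 (f : lip0) : lip_norm f = 0 -> f = 0.
Proof.
move=> f0; apply: val_inj; apply/funext => x; apply/eqP.
rewrite -normr_le0; have := lip_normP f x x0.
by rewrite f0 mul0r lip0_base subr0.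
Qed.

HB.instance Definition _ :=
  Lmodule_isNormed.Build R lip0 lip_normD lip_normZ lip_norm0_eq0.

Lemma eval_dual (x : X) : (fun f : lip0 => f x) \in dual_pred lip0.
Proof.
apply/dual_predP; split => //.
exists (mdist x x0) => f; have := lip_normP f x x0.
by rewrite lip0_base subr0 mulrC.
Qed.

Definition delta (x : X) : dual lip0 := Dual (eval_dual x).

Definition delta_span : set (dual lip0) :=
  [set mu | exists s : seq (R * X), mu = \sum_(p <- s) p.1 *: delta p.2].

Definition free_space : set (dual lip0) := closure delta_span.

Definition W1 (mu eta : free_space) : R := `|set_val mu - set_val eta|.

(* Coarsest topology on lip0 making f |-> mu f continuous for all mu in the
   free space. *)
Definition weak_star : Type := initial_topology
  ((fun f mu => set_val mu f) : lip0 -> {ptws free_space -> R}).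

HB.instance Definition _ := Topological.on weak_star.

End lip0.
Arguments lip0_pred {R X} x0 _.
Arguments free_space {R X} x0 _.

Section submetric.
Context {R : realType} {X : metricType R} (M : set X).

Let sub_dist (x y : M) : R := mdist (set_val x) (set_val y).

Let sub_dist_ge0 x y : 0 <= sub_dist x y.
Proof. exact: mdist_ge0. Qed.

Let sub_dist_positivity x y : sub_dist x y = 0 -> x = y.
Proof. by move=> /mdist_positivity; exact: val_inj. Qed.

Let sub_ballE (x : M) (d : R) : ball x d = [set y | sub_dist x y < d].
Proof.
apply/seteqP; split => y /=.
  by rewrite /ball/= /initial_ball ballEmdist.
by rewrite /ball/= /initial_ball ballEmdist.
Qed.

HB.instance Definition _ := @PseudoMetric_isMetric.Build R (set_type M)
  sub_dist sub_dist_ge0 sub_dist_positivity sub_ballE.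

End submetric.

Section extension.
Context {R : realType} {X : metricType R} (M : set X) (x0 : X) (Mx0 : M x0).

Definition sub_base : M := SigSub (mem_set Mx0).

Definition random_projection (K : R) (upsilon : X -> free_space sub_base) :=
  (forall x : M, set_val (upsilon (set_val x)) = delta sub_base x) /\
  (forall x y : X, W1 (upsilon x) (upsilon y) <= K * mdist x y).

Definition extension_operator (E : lip0 sub_base -> lip0 x0) : Prop :=
  forall (f : lip0 sub_base) (x : M), E f (set_val x) = f x.

Definition weak_star_continuous (E : lip0 sub_base -> lip0 x0) : Prop :=
  continuous (E : weak_star sub_base -> weak_star x0).

End extension.

(* Main.v *)
Require Import Defs.
From HB Require Import structures.
From mathcomp Require Import all_boot all_order all_algebra.
From mathcomp Require Import all_classical all_reals all_analysis.

Set Implicit Arguments.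
Unset Strict Implicit.
Unset Printing Implicit Defensive.

Import Order.TTheory GRing.Theory Num.Theory.
Import numFieldNormedType.Exports.

Local Open Scope classical_set_scope.
Local Open Scope ring_scope.

(** A random projection and an extension operator determine each other through
    [E f x = upsilon x f]: the two Lipschitz bounds are then the same estimate,
    and [upsilon x] is the functional [delta x \o E].  What remains is that
    such an [E] is weak*-weak* continuous iff every [delta x \o E] lies in the
    free space of [M].  This rests on two facts: the free space is exactly the
    set of weak*-continuous functionals, since a functional vanishing on the
    common kernel of finitely many others is a combination of them; and
    [mu |-> mu \o E] is norm continuous, so it suffices to test it on the
    [delta x], whose span is dense in the free space of [X]. *)

Section dual_complements.
Context {R : realType}.

Lemma dual_norm_le (V : normedModType R) (mu : dual V) (L : R) :
  0 <= L -> (forall v, `|mu v| <= L * `|v|) -> `|mu| <= L.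
Proof. exact: opnorm_le. Qed.

Lemma dual_normP (V : normedModType R) (mu : dual V) v :
  `|mu v| <= `|mu| * `|v|.
Proof. exact: (opnormP (dual_bounded mu)). Qed.

Lemma dual_linearE (V : normedModType R) (mu : dual V) (a : R) u v :
  mu (a *: u + v) = a * (mu u : R) + (mu v : R) :> R.
Proof. exact: dual_linear. Qed.

Lemma dual0 (V : normedModType R) (mu : dual V) : mu 0 = 0 :> R.
Proof.
by have := dual_linearE mu (-1) 0 0; rewrite scaler0 addr0 mulN1r addNr.
Qed.

Lemma dualZ (V : normedModType R) (mu : dual V) (a : R) v :
  mu (a *: v) = a * (mu v : R) :> R.
Proof. by rewrite -[_ *: v]addr0 dual_linearE dual0 addr0. Qed.

Lemma dual_of_common_kernel (V : normedModType R) (S : set (dual V)) :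
  S 0 -> (forall a mu nu, S mu -> S nu -> S (a *: mu + nu)) ->
  forall (s : seq (dual V)) (phi : dual V), (forall mu, mu \in s -> S mu) ->
  (forall v, (forall mu, mu \in s -> mu v = 0) -> phi v = 0) -> S phi.
Proof.
move=> S0 Slin; elim=> [|mu s IHs] phi sS kerP.
  suff -> : phi = 0 by [].
  by apply: val_inj; apply/funext => v; exact: kerP.
have sS' nu : nu \in s -> S nu by move=> nus; apply: sS; rewrite inE nus orbT.
have [[v [sv muv]]|noV] :=
    pselect (exists v, (forall nu, nu \in s -> nu v = 0) /\ mu v != 0).
  have -> : phi = (phi v / mu v) *: mu + (- (phi v / mu v) *: mu + phi).
    by rewrite addrA -scalerDl subrr scale0r add0r.
  apply: Slin; first by apply: sS; rewrite mem_head.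
  apply: IHs => // w sw.
  (* Moving [w] along [v] brings it into the kernel of [mu] without leaving that of the tail. *)
  have : phi (- ((mu w : R) / mu v) *: v + w) = 0.
    apply: kerP => nu; rewrite inE => /orP[/eqP ->|nus]; rewrite dual_linearE.
      by rewrite mulNr divfK// addNr.
    by rewrite (sv nu)// (sw nu)// mulr0 addr0.
  rewrite dual_linearE => <-.
  rewrite [LHS]/(- ((phi v : R) / mu v) * (mu w : R) + (phi w : R)).
  by rewrite !mulNr mulrAC [in RHS]mulrAC (mulrC (mu w : R)).
apply: IHs => // w sw; apply: kerP => nu; rewrite inE => /orP[/eqP ->|].
  by apply: contrapT => /eqP muw; apply: noV; exists w.
exact: sw.
Qed.

Section dual_comp.
Context (V W : normedModType R) (E : {linear V -> W}) (bE : bounded_op E).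

Lemma dual_comp_subproof (mu : dual W) : ((mu : W -> R^o) \o E) \in dual_pred V.
Proof.
apply/dual_predP; split=> [a u v|]; first by rewrite /= linearP dual_linear.
exists (`|mu| * opnorm E) => v; rewrite (le_trans (dual_normP _ _))//.
by rewrite -mulrA ler_wpM2l// opnormP.
Qed.

Definition dual_comp (mu : dual W) : dual V := Dual (dual_comp_subproof mu).

Lemma dual_comp_is_linear : linear dual_comp.
Proof. by move=> a mu nu; apply: val_inj. Qed.

HB.instance Definition _ :=
  GRing.isLinear.Build R (dual W) (dual V) _ dual_comp dual_comp_is_linear.

Lemma dual_comp_norm_le (mu : dual W) : `|dual_comp mu| <= opnorm E * `|mu|.
Proof.
apply: dual_norm_le => [|v]; first by rewrite mulr_ge0// opnorm_ge0.
rewrite (le_trans (dual_normP mu _))// [leRHS]mulrAC [leRHS]mulrC.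
by rewrite ler_wpM2l// opnormP.
Qed.

Lemma dual_comp_continuous : continuous dual_comp.
Proof.
apply: bounded_linear_continuous; apply/linear_boundedP.
near=> r => mu; rewrite (le_trans (dual_comp_norm_le mu))// ler_wpM2r//.
Unshelve. all: by end_near. Qed.

End dual_comp.
End dual_complements.

Lemma closure_sub_preimage (T U : topologicalType) (f : T -> U) (A : set T)
    (B : set U) :
  continuous f -> A `<=` f @^-1` closure B -> closure A `<=` f @^-1` closure B.
Proof.
move=> fc AB; rewrite closureE; apply: smallest_sub => //.
by apply: preimage_closed => [x _|]; [exact: fc|exact: closed_closure].
Qed.

(** Limits are taken in one variable at a time, first in [v] with [u] fixed in the closure, then in
    [u] with [v] fixed in [A]. *)
Lemma closure_linear (R : realType) (V : normedModType R) (A : set V) :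
  (forall a u v, A u -> A v -> A (a *: u + v)) ->
  forall a u v, closure A u -> closure A v -> closure A (a *: u + v).
Proof.
move=> Alin a u v Au; move: v.
apply: (@closure_sub_preimage _ _ (fun v => a *: u + v)).
  by move=> v; apply: cvgD; [exact: cvg_cst|exact: cvg_id].
move=> v Av; move: u Au.
apply: (@closure_sub_preimage _ _ (fun u => a *: u + v)).
  by move=> u; apply: cvgD; [exact: scaler_continuous|exact: cvg_cst].
by move=> u Au; apply: subset_closure; exact: Alin.
Qed.

Section free_space_complements.
Context {R : realType} (X : metricType R) (x0 : X).

Lemma delta_free x : free_space x0 (delta x0 x).
Proof.
apply: subset_closure; exists [:: (1, x)].
by rewrite big_seq1 scale1r.
Qed.

Lemma free_space0 : free_space x0 0.
Proof. by apply: subset_closure; exists [::]; rewrite big_nil. Qed.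

Lemma free_space_linear a (mu nu : dual (lip0 x0)) :
  free_space x0 mu -> free_space x0 nu -> free_space x0 (a *: mu + nu).
Proof.
apply: closure_linear => {}a {mu nu}_ _ [s ->] [t ->].
exists ([seq (a * p.1, p.2) | p <- s] ++ t).
rewrite big_cat big_map scaler_sumr; congr (_ + _).
by apply: eq_bigr => p _; rewrite scalerA.
Qed.

(** Stated for arbitrary filters because it is applied to filters of annihilators and to images
    under an operator, as well as to neighborhoods. *)
Lemma cvg_weak_star (F : set_system (lip0 x0)) (f : lip0 x0) : Filter F ->
  F --> (f : weak_star x0) <->
  forall mu, free_space x0 mu -> (mu : lip0 x0 -> R) @ F --> (mu f : R).
Proof.
move=> FF; pose ev (g : lip0 x0) (mu : free_space x0) : R := set_val mu g.
split=> [Ff mu Fmu|Ff].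
  have : ev @ F --> (ev f : {ptws free_space x0 -> R}).
    exact: cvg_comp Ff (@initial_continuous _ _ _ f).
  by move/pointwise_cvgP => /(_ (SigSub (mem_set Fmu))).
have evF : ev @ F --> (ev f : {ptws free_space x0 -> R}).
  by apply/pointwise_cvgP => mu; apply: Ff; exact: set_valP.
(* A weak* neighborhood of [f] contains the preimage under [ev] of an open set around [ev f]. *)
move=> A [_ [[B oB <-] Bf] BA]; apply: (filterS BA).
by apply: evF; exact: open_nbhs_nbhs.
Qed.

Lemma free_space_weak_star_continuous (phi : dual (lip0 x0)) :
  continuous ((phi : lip0 x0 -> R) : weak_star x0 -> R) <-> free_space x0 phi.
Proof.
split=> [phic|Fphi f]; last first.
  have /cvg_weak_star := @cvg_id _ (nbhs (f : weak_star x0)); exact.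
(* Annihilators of finite subsets of the free space generate a filter finer
   than the weak* neighborhoods of 0, so no description of the latter is needed. *)
pose K (s : seq (dual (lip0 x0))) :=
  [set f : lip0 x0 | forall mu, mu \in s -> mu f = 0].
pose F := filter_from
  [set s : seq (dual (lip0 x0)) | forall mu, mu \in s -> free_space x0 mu] K.
have FF : Filter F.
  apply: filter_from_filter; first by exists [::].
  move=> s t Fs Ft; exists (s ++ t) => [mu|f Kf].
    by rewrite mem_cat => /orP[/Fs|/Ft].
  by split=> mu smu; apply: Kf; rewrite mem_cat smu ?orbT.
have F0 : F --> ((0 : lip0 x0) : weak_star x0).
  apply/cvg_weak_star => mu Fmu A /nbhs_singleton A0.
  exists [:: mu] => [nu|f Kf]; first by rewrite inE => /eqP ->.
  have muf0 : mu f = mu 0 by rewrite Kf ?mem_head// dual0.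
  by rewrite /= muf0.
(* Continuity at 0 bounds [phi] by 1 on the annihilator of a finite [s]; as this is a subspace,
   [phi] must vanish there. *)
have [s Fs sphi] : F [set f | `|phi f| < 1].
  apply: F0; apply: (phic (0 : lip0 x0) [set r | `|r| < 1]).
  rewrite dual0; apply/nbhs_ballP; exists 1 => //= r.
  by rewrite /ball /= sub0r normrN.
apply: (@dual_of_common_kernel _ _ _ free_space0 free_space_linear s) => // f Kf.
apply: contrapT => /eqP phif.
(* The rescaled vector stays in the annihilator, but [phi] equals 1 on it. *)
have : `|phi ((phi f : R)^-1 *: f)| < 1.
  by apply: sphi => mu smu; rewrite dualZ (Kf mu)// mulr0.
by rewrite dualZ mulVf// normr1 ltxx.
Qed.

End free_space_complements.

Section weak_star_operators.
Context {R : realType} (X Y : metricType R) (x0 : X) (y0 : Y).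
Context (E : {linear lip0 x0 -> lip0 y0}) (bE : bounded_op E).

Lemma weak_star_continuous_delta :
  continuous ((E : lip0 x0 -> lip0 y0) : weak_star x0 -> weak_star y0) <->
  forall y, free_space x0 (dual_comp bE (delta y0 y)).
Proof.
split=> [Ec y|Ed f].
  apply/free_space_weak_star_continuous => f.
  have /free_space_weak_star_continuous dc := @delta_free _ _ y0 y.
  exact: (@continuous_comp (weak_star x0) (weak_star y0) R E _ f (Ec f) (dc _)).
have EF : free_space y0 `<=` dual_comp bE @^-1` free_space x0.
  apply: closure_sub_preimage; first exact: dual_comp_continuous.
  move=> _ [s ->] /=; elim: s => [|p s IHs].
    by rewrite big_nil linear0; exact: free_space0.
  by rewrite big_cons linearP; apply: free_space_linear => //; exact: Ed.
have Ff : Filter (nbhs (f : weak_star x0)).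
  by apply: (@nbhs_filter (weak_star x0)).
(* Convergence of the image filter is tested against each [mu], where it becomes weak* continuity of
   [mu \o E]. *)
apply: (cvg_weak_star _ (fmap_filter E Ff)).2 => mu Fmu.
by move/free_space_weak_star_continuous : (EF _ Fmu); exact.
Qed.

End weak_star_operators.

Theorem theorem2p15 (R : realType) (X : metricType R) (x0 : X) (M : set X)
    (M_closed : closed M) (Mx0 : M x0) (K : R) (K_ge1 : 1 <= K) :
  (exists upsilon : X -> free_space (sub_base Mx0),
      random_projection K upsilon)
  <->
  (exists E : {linear lip0 (sub_base Mx0) -> lip0 x0},
      [/\ bounded_op E, extension_operator E, opnorm E <= K
        & weak_star_continuous E]).
Proof.
have K0 : 0 <= K by rewrite (le_trans ler01).
split=> [[u [uM uK]]|[E [bE EM EK Ec]]].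
  have uL f x y : `|set_val (u x) f - set_val (u y) f| <= K * `|f| * mdist x y.
    rewrite -[_ - _]/((set_val (u x) - set_val (u y)) f).
    by rewrite (le_trans (dual_normP _ _))// mulrAC ler_wpM2r//; exact: uK.
  have EP f : (fun x => set_val (u x) f) \in lip0_pred x0.
    apply/lip0_predP; split.
      (* The base point lies in [M], so the projection there is its [delta], which kills [f]. *)
      by have := uM (sub_base Mx0); rewrite /= => ->; exact: (lip0_base f).
    by exists (K * `|f|) => x y; exact: uL.
  pose E f : lip0 x0 := Lip0 (EP f).
  have El : linear E.
    by move=> a f g; apply: val_inj; apply/funext => x; exact: dual_linear.
  pose Elin := GRing.isLinear.Build R _ _ _ E El.
  pose EL : {linear lip0 (sub_base Mx0) -> lip0 x0} := HB.pack E Elin.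
  have EK f : `|EL f| <= K * `|f|.
    by apply: lip_norm_le => [|x y]; [rewrite mulr_ge0|exact: uL].
  have bE : bounded_op EL by exists K.
  exists EL; split => //; [|exact: opnorm_le|].
    by move=> f x; rewrite /= uM.
  apply/(weak_star_continuous_delta bE) => x.
  have <- : set_val (u x) = dual_comp bE (delta x0 x) by exact: val_inj.
  exact: set_valP.
have Efree : forall x, free_space (sub_base Mx0) (dual_comp bE (delta x0 x)).
  exact/weak_star_continuous_delta.
exists (fun x => SigSub (mem_set (Efree x))); split => [x|x y].
  (* For [x] in [M], [delta x \o E] is evaluation at [x], since [E f] extends [f]. *)
  by apply: val_inj; apply/funext => f; exact: EM.
rewrite /W1 /=; apply: dual_norm_le => [|f].
  by rewrite mulr_ge0// mdist_ge0.
have EfK : `|E f| <= K * `|f|.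
  by rewrite (le_trans (opnormP bE f))// ler_wpM2r.
rewrite (le_trans (lip_normP (E f) x y))// mulrAC.
by apply: ler_wpM2r EfK; exact: mdist_ge0.
Qed.
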